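(* For integers $n\ge 1$ and $k\ge 1$, let $a_{n,k}(213)$ denote the number of cyclic permutations $\pi\in\mathfrak S_n$ whose one-line notation avoids $\delta_k=k(k-1)\cdots 21$ and whose cycle form $C(\pi)$ avoids $213$. Then for $n\geq 2$ and $k\geq 4$, \[a_{n,k}(213) = \sum_{i=1}^{n-1} a_{i,k}(213)\,a_{n-i,k-1}(213),\] with base cases: $a_{1,1}(213)=0$ and $a_{1,k}(213) = 1$ for $k \geq 2$; $a_{n,1}(213) = a_{n,2}(213) = 0$ for $n \geq 2$; and $a_{n,3}(213) = 2^{n-2}$ for $n \geq 2$.
   Context: A permutation $\pi\in\mathfrak S_n$ is cyclic if it consists of a single $n$-cycle. For a cyclic $\pi$, its cycle form is $C(\pi)=(1,c_2,\dots,c_n)$ with $c_2=\pi(1)$ and $c_{i+1}=\pi(c_i)$; it is regarded as the sequence $1c_2\cdots c_n$ for pattern purposes. A sequence of distinct integers avoids a pattern $\sigma\in\mathfrak S_m$ if it has no subsequence of length $m$ in the same relative order as $\sigma$. The one-line notation of $\pi$ is $\pi_1\pi_2\cdots\pi_n$ with $\pi_i=\pi(i)$. *)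

(* Defs.v *)
From mathcomp Require Import all_boot all_fingroup.
Set Implicit Arguments. Unset Strict Implicit. Unset Printing Implicit Defensive.

(* Permutations of {1..n} are modelled as 'S_n acting on 'I_n = {0..n-1};
   all values are shifted down by 1, which does not affect relative order. *)

Definition contains (s p : seq nat) : bool :=
  [exists f : {ffun 'I_(size p) -> 'I_(size s)},
    [forall i : 'I_(size p), forall j : 'I_(size p),
      ((i < j) ==> (f i < f j)) &&
      ((nth 0 s (f i) < nth 0 s (f j)) == (nth 0 p i < nth 0 p j))]].

Definition avoids (s p : seq nat) : bool := ~~ contains s p.

Definition delta (k : nat) : seq nat := rev (iota 1 k).

Definition pat213 : seq nat := [:: 2; 1; 3].

Definition cyclic_perm n (s : 'S_n) : bool := #|porbits s| == 1.

Definition one_line n (s : 'S_n) : seq nat := [seq val (s i) | i <- enum 'I_n].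

Definition cycle_form m (s : 'S_m.+1) : seq nat :=
  [seq val ((s ^+ i)%g ord0) | i <- iota 0 m.+1].

(* a_{n,k}(213), for n >= 1 (value at n = 0 is irrelevant, set to 0) *)
Definition a (n k : nat) : nat :=
  match n with
  | 0 => 0
  | m.+1 => #|[set s : 'S_m.+1 | [&& cyclic_perm s,
                 avoids (one_line s) (delta k) & avoids (cycle_form s) pat213]]|
  end.

(* Main.v *)
Require Import Defs.
From mathcomp Require Import all_boot all_fingroup zify.
Set Implicit Arguments. Unset Strict Implicit. Unset Printing Implicit Defensive.

(* A word starting with its minimum and avoiding 213 has the form 0 i L S with L
   above i and S below i, so it is glued from the cycles c = 0 S and d = i L (shifted
   down by i). On one-line notations, a glued word is i s' t', where the line of c is
   h s' and t' is the line of d shifted by i, its minimum being replaced by h. Writing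
   lds for the length of a longest decreasing subsequence,
     lds (glue c d) = max (1 + lds (s' h)) (lds d),
   which brings in the rotated line s' h of c. Its lds obeys a similar rule involving
   the line of d without its minimum, and removing the minimum from either line leads
   to no further statistic. The four resulting convolution recurrences show that the
   counts of words with lds < k coincide for lines, rotated lines and lines without
   minimum as soon as k >= 3, and the first recurrence becomes the one of the theorem. *)


(** * Pattern containment through subsequences *)

Lemma sorted_ltn_subseq_iota n (l : seq nat) :
  sorted ltn l -> all (ltn^~ n) l -> subseq l (iota 0 n).
Proof.
move=> sl /allP l_lt.
have -> : l = [seq x <- iota 0 n | x \in l].
  apply: (irr_sorted_eq ltn_trans ltnn) => //.
    by rewrite sorted_filter ?iota_ltn_sorted //; apply: ltn_trans.
  move=> x; rewrite mem_filter mem_iota /= add0n.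
  by case: (boolP (x \in l)) => // /l_lt /= ->.
exact: filter_subseq.
Qed.

(** An embedding [f] is an increasing list of positions, whose entries form [u]. Conversely, the
    mask that cuts [u] out of [s], applied to the positions of [s], gives [f]. *)
Lemma containsP (s p : seq nat) :
  reflect (exists u, [/\ subseq u s, size u = size p &
             forall i j, i < size p -> j < size p ->
               (nth 0 u i < nth 0 u j) = (nth 0 p i < nth 0 p j)])
          (contains s p).
Proof.
apply: (iffP existsP) => [[f /forallP Hf] | [u [/subseqP[m sz_m ->] sz_u Hu]]].
  have f_incr (i j : 'I_(size p)) : i < j -> f i < f j.
    by move=> ij; have /forallP/(_ j)/andP[/implyP/(_ ij)] := Hf i.
  exists [seq nth 0 s (f i) | i <- enum 'I_(size p)]; split.
  - rewrite (map_comp (nth 0 s) (fun i => val (f i))).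
    rewrite -[X in subseq _ X](mkseq_nth 0 s) /mkseq; apply: map_subseq.
    apply: sorted_ltn_subseq_iota.
      rewrite sorted_map.
      have : sorted (relpre val ltn) (enum 'I_(size p)).
        by rewrite -sorted_map val_enum_ord iota_ltn_sorted.
      by apply: sub_sorted => i j; apply: f_incr.
    by apply/allP=> _ /mapP[i _ ->] /=.
  - by rewrite size_map size_enum_ord.
  - move=> i j ip jp.
    have /forallP/(_ (Ordinal jp))/andP[_ /eqP Hij] := Hf (Ordinal ip).
    have nthE x (xp : x < size p) :
        nth 0 [seq nth 0 s (f i) | i <- enum 'I_(size p)] x = nth 0 s (f (Ordinal xp)).
      rewrite (nth_map (Ordinal xp)) ?size_enum_ord //; congr (nth 0 s (f _)).
      by apply: val_inj; rewrite /= nth_enum_ord.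
    by rewrite !nthE Hij.
have def_u : mask m s = [seq nth 0 s i | i <- mask m (iota 0 (size s))].
  by rewrite map_mask -[in LHS](mkseq_nth 0 s).
set l := mask m (iota 0 (size s)) in def_u.
have sz_l : size l = size p by rewrite -sz_u def_u size_map.
have l_lt i : i < size p -> nth 0 l i < size s.
  move=> ip; have : nth 0 l i \in l by rewrite mem_nth ?sz_l.
  by move/mem_mask; rewrite mem_iota.
exists [ffun i : 'I_(size p) => Ordinal (l_lt i (ltn_ord i))].
apply/forallP=> i; apply/forallP=> j; rewrite !ffunE /=; apply/andP; split.
  apply/implyP=> ij.
  have sl : sorted ltn l by apply: sorted_mask (iota_ltn_sorted _ _); apply: ltn_trans.
  by apply: (sorted_ltn_nth ltn_trans); rewrite ?inE ?sz_l.
by rewrite -Hu // def_u !(nth_map 0) ?sz_l.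
Qed.

Lemma avoids213P (s : seq nat) :
  reflect (forall x y z, subseq [:: x; y; z] s -> y < x -> x < z -> False)
          (avoids s pat213).
Proof.
apply: (iffP idP) => [av x y z sub yx xz | H].
  apply: (negP av); apply/containsP; exists [:: x; y; z]; split => //.
  by case=> [|[|[|i]]] [|[|[|j]]] //= _ _; lia.
apply/negP=> /containsP[[|x [|y [|z [|? ?]]]] [sub //= _ Hu]].
apply: (H _ _ _ sub); first by have := Hu 1 0 isT isT.
by have := Hu 0 2 isT isT.
Qed.

Lemma avoids213_subseq (s t : seq nat) :
  subseq s t -> avoids t pat213 -> avoids s pat213.
Proof.
move=> st /avoids213P H; apply/avoids213P => x y z sub.
by apply: H; apply: subseq_trans st.
Qed.

Lemma avoids213_map (f : nat -> nat) (s : seq nat) :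
  {mono f : x y / x < y} -> avoids (map f s) pat213 = avoids s pat213.
Proof.
move=> fm; apply/avoids213P/avoids213P => H x y z sub.
  move=> yx xz; apply: (H (f x) (f y) (f z)); rewrite ?fm //.
  exact: (map_subseq f sub).
case/subseqP: sub => m _; rewrite -map_mask.
case E: (mask m s) => [|x' [|y' [|z' [|? ?]]]] //= [-> -> ->]; rewrite !fm.
by apply: H; rewrite -E mask_subseq.
Qed.

Lemma nth_delta k i : i < k -> nth 0 (delta k) i = k - i.
Proof. by move=> ik; rewrite /delta nth_rev size_iota // nth_iota; lia. Qed.

Lemma contains_deltaP (s : seq nat) k :
  reflect (exists u, [/\ subseq u s, size u = k & sorted gtn u])
          (contains s (delta k)).
Proof.
have szd : size (delta k) = k by rewrite size_rev size_iota.
have gtn_tr : transitive gtn by move=> ? ? ? /=; lia.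
apply: (iffP (containsP _ _)); rewrite szd => -[u [sub sz_u Hu]]; exists u; split=> //.
  apply/(sortedP 0) => i; rewrite sz_u => ik /=.
  by rewrite Hu ?nth_delta //; lia.
have {}Hu i j : i < k -> j < k -> i < j -> nth 0 u j < nth 0 u i.
  by move=> ik jk ij; apply: (sorted_ltn_nth gtn_tr 0 Hu); rewrite ?inE ?sz_u.
move=> i j ik jk; rewrite !nth_delta //; case: (ltngtP i j) => [ij|ji|->]; last lia.
  by have := Hu i j ik jk ij; lia.
by have := Hu j i jk ik ji; lia.
Qed.

(** * Longest decreasing subsequences *)

(* [lds_below b s] is the length of a longest strictly decreasing subsequence of
   [s] with entries less than [b]. *)
Fixpoint lds_below b (s : seq nat) :=
  if s is x :: s' then
    if x < b then maxn (lds_below b s') (lds_below x s').+1 else lds_below b s'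
  else 0.

Fixpoint lds (s : seq nat) :=
  if s is x :: s' then maxn (lds s') (lds_below x s').+1 else 0.

Lemma lds_below_filter_leq b c s :
  b <= c -> lds_below b [seq x <- s | x < c] = lds_below b s.
Proof.
elim: s b => //= x s IHs b bc; case: (ltnP x c) => xc /=.
  by rewrite !IHs ?(ltnW xc).
by rewrite ltnNge (leq_trans bc xc) /= IHs.
Qed.

Lemma lds_below_filter b s : lds_below b s = lds [seq x <- s | x < b].
Proof.
elim: s b => //= x s IHs b; case: ifP => xb /=; rewrite -IHs //.
by rewrite lds_below_filter_leq // ltnW.
Qed.

Lemma lds_cons x s : lds (x :: s) = maxn (lds s) (lds [seq y <- s | y < x]).+1.
Proof. by rewrite /= lds_below_filter. Qed.

(** Induction along [lds_cons], which calls [lds] on the tail and on the part of the tail below the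
    head. *)
Lemma lds_ind (P : seq nat -> Prop) :
  P [::] -> (forall x s, P s -> P [seq y <- s | y < x] -> P (x :: s)) -> forall s, P s.
Proof.
move=> P0 Pc s; elim: {s}(size s) {-2}s (leqnn (size s)) => [|n IHn] [|x s] //= szs.
by apply: Pc; apply: IHn => //; rewrite size_filter; apply: leq_trans (count_size _ _) _.
Qed.

Lemma lds_map (f : nat -> nat) s : {mono f : x y / x < y} -> lds (map f s) = lds s.
Proof.
move=> fm; elim/lds_ind: s => // x s IH1 IH2.
rewrite map_cons !lds_cons filter_map IH1 -IH2; congr (maxn _ (lds (map _ _)).+1).
by apply: eq_filter => y /=; apply: fm.
Qed.

Lemma filterC (p q : pred nat) s :
  [seq x <- [seq x <- s | p x] | q x] = [seq x <- [seq x <- s | q x] | p x].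
Proof. by rewrite -!filter_predI; apply: eq_filter => x /=; rewrite andbC. Qed.

Lemma lds_filter (p : pred nat) s : lds [seq x <- s | p x] <= lds s.
Proof.
elim/lds_ind: s => // x s IH1; rewrite filterC => IH2.
rewrite [filter _ (_ :: _)]/=; case: (p x); rewrite !lds_cons; last by lia.
by rewrite geq_max !leq_max IH1 /= orbC ltnS; rewrite IH2.
Qed.

(** A strictly decreasing subsequence uses the value 0 at most once. *)
Lemma lds_leq_pos s : lds s <= (lds [seq x <- s | 0 < x]).+1.
Proof.
elim/lds_ind: s => // x s IH1; rewrite filterC => IH2.
rewrite [[seq _ <- _ :: _ | _]]/=; case: x IH2 => [|x] IH2; rewrite !lds_cons /=.
  by rewrite (@eq_filter _ _ pred0) ?filter_pred0 //=; lia.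
by lia.
Qed.

Lemma lds_rcons s x : lds (rcons s x) = maxn (lds s) (lds [seq y <- s | x < y]).+1.
Proof.
elim/lds_ind: s => // y s IH1 IH2.
rewrite rcons_cons !lds_cons filter_rcons IH1 [filter _ (y :: s)]/=.
by case: ifP IH2 => xy IH2; rewrite ?lds_cons ?IH2 1?[in RHS]filterC; lia.
Qed.

(** A decreasing subsequence that starts in [s] stays below [b], so it meets only the entries of [t]
    below [b]; any other one lies inside [t]. *)
Lemma lds_cat b s t : all (ltn^~ b) s ->
  lds (s ++ t) = maxn (lds (s ++ [seq x <- t | x < b])) (lds t).
Proof.
elim: s => [_|x s IHs /= /andP[xb sb]]; first by rewrite !cat0s (maxn_idPr (lds_filter _ _)).
rewrite -!/(lds (_ :: _)) !lds_cons (IHs sb) !filter_cat.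
have -> : [seq y <- [seq z <- t | z < b] | y < x] = [seq y <- t | y < x].
  by rewrite -filter_predI; apply: eq_filter => y /=; lia.
by lia.
Qed.

Lemma lds_subseq u s : subseq u s -> sorted gtn u -> size u <= lds s.
Proof.
elim/lds_ind: s u => [|x s IH1 IH2] u; first by rewrite subseq0 => /eqP->.
case: u => // y u sub; rewrite lds_cons; move: sub => /=; case: eqP => [->|_] sub su.
  rewrite leq_max; apply/orP; right; rewrite ltnS; apply: IH2; last exact: path_sorted su.
  have au : all (gtn x) u by apply: order_path_min su => ? ? ? /=; lia.
  by rewrite subseq_filter sub andbT; apply: sub_all au.
by apply: leq_trans (leq_maxl _ _); apply: (IH1 (y :: u)).
Qed.

Lemma lds_witness s : exists u, [/\ subseq u s, sorted gtn u & size u = lds s].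
Proof.
elim/lds_ind: s => [|x s [u [s1 so1 z1]] [v [s2 so2 z2]]]; first by exists [::].
rewrite lds_cons; case: (leqP (lds s) (lds [seq y <- s | y < x]).+1) => _.
  exists (x :: v); split; rewrite /= ?z2 //.
    by rewrite eqxx; apply: subseq_trans s2 (filter_subseq _ _).
  rewrite path_min_sorted //; apply/allP => y /(mem_subseq s2).
  by rewrite mem_filter => /andP[].
by exists u; split=> //; apply: subseq_trans s1 (subseq_cons _ _).
Qed.

(** A decreasing subsequence of length at least [k] can be truncated to its first [k] entries. *)
Lemma avoids_delta s k : avoids s (delta k) = (lds s < k).
Proof.
rewrite ltnNge; congr negb; apply/contains_deltaP/idP => [[u [sub <- su]] | lk].
  exact: lds_subseq.
have [u [sub su szu]] := lds_witness s.
exists (take k u); split; last exact: take_sorted.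
  exact: subseq_trans (take_subseq _ _) sub.
by rewrite size_takel ?szu.
Qed.


(** * Cycle words, their one-line notation and gluing *)

(* If [c] is the cycle form of a cyclic permutation, this is its one-line notation. *)
Definition word_line (c : seq nat) := mkseq (next c) (size c).

Definition glue (c d : seq nat) := 0 :: map (addn (size c)) d ++ behead c.

(** These words turn out to be exactly the 213-avoiding cycle forms of cyclic permutations of size
    [n]. *)
Definition cycle_words n :=
  [seq c <- permutations (iota 0 n) | (ohead c == Some 0) && avoids c pat213].

Lemma mem_cycle_words n c : (c \in cycle_words n) =
  [&& perm_eq c (iota 0 n), ohead c == Some 0 & avoids c pat213].
Proof. by rewrite mem_filter mem_permutations andbC. Qed.

Lemma cycle_words_uniq n : uniq (cycle_words n).
Proof. by rewrite filter_uniq // permutations_uniq. Qed.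

Lemma cycle_wordsP n c : c \in cycle_words n ->
  exists c', [/\ c = 0 :: c', uniq c, size c = n, (forall x, (x \in c) = (x < n))
                & avoids c pat213].
Proof.
rewrite mem_cycle_words => /and3P[pc]; case: c pc => [|x c'] //= pc /eqP[x0] av.
rewrite x0 in pc av *; exists c'; split=> //.
- by have := perm_uniq pc; rewrite iota_uniq.
- by have := perm_size pc; rewrite size_iota.
- by move=> y; rewrite (perm_mem pc) mem_iota.
Qed.

Lemma cycle_words_intro n c' : uniq (0 :: c') -> size (0 :: c') = n ->
  {in c', forall x, x < n} -> avoids (0 :: c') pat213 -> 0 :: c' \in cycle_words n.
Proof.
move=> uc szc cn av; rewrite mem_cycle_words av eqxx !andbT /=.
have sub : {subset 0 :: c' <= iota 0 n}.
  move=> x; rewrite mem_iota inE => /predU1P[->|/cn //]; by rewrite -szc.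
have le : size (iota 0 n) <= size (0 :: c') by rewrite size_iota szc.
apply: uniq_perm => //; first exact: iota_uniq.
by case: (uniq_min_size uc sub le).
Qed.

Lemma next_cons0 c x : x \in 0 :: c -> next (0 :: c) x = nth 0 c (index x (0 :: c)).
Proof. by move=> xc; rewrite next_nth xc. Qed.

(** On a word without repetition, [next] is injective with inverse [prev], and it maps the entries
    to entries. *)
Lemma perm_word_line n c : c \in cycle_words n -> perm_eq (word_line c) (iota 0 n).
Proof.
case/cycle_wordsP=> c' [_ uc szc memc _].
have u : uniq (word_line c).
  by rewrite map_inj_uniq ?iota_uniq //; apply: can_inj (prev_next uc).
have sub : {subset word_line c <= iota 0 n}.
  move=> y /mapP[x]; rewrite mem_iota szc => /andP[_ xn] ->.
  by rewrite mem_iota /= add0n -memc mem_next memc.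
apply: uniq_perm; rewrite ?iota_uniq //.
by case: (uniq_min_size u sub); rewrite ?size_mkseq ?szc ?size_iota.
Qed.

(* Gluing two cycles amounts to exchanging, in the one-line notation of their
   direct sum, the first value of the first one and the value 0 of the second. *)
Lemma glue_line i j c d : c \in cycle_words i -> d \in cycle_words j ->
  word_line (glue c d) = i :: behead (word_line c) ++
    [seq if x == 0 then head 0 (word_line c) else i + x | x <- word_line d].
Proof.
case/cycle_wordsP=> c' [-> uc szc memc _] /cycle_wordsP[d' [-> ud szd memd _]].
have [c'0 uc'] : 0 \notin c' /\ uniq c' by apply/andP.
have szg : size (glue (0 :: c') (0 :: d')) = i + j.
  by rewrite /glue /= size_cat size_map; move: szc szd => /=; lia.
have i_gt0 : 0 < i by rewrite -szc.
have add_inj : injective (addn i) by move=> x y; lia.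
have index0 x (s : seq nat) : x != 0 -> index x (0 :: s) = (index x s).+1.
  by move=> x0; rewrite /= eq_sym (negPf x0).
(* The default 0 covers empty [c'], where 0 is its own successor. *)
have headE : head 0 (word_line (0 :: c')) = nth 0 c' 0.
  by rewrite /=; case: (c').
have line_c : behead (word_line (0 :: c')) = [seq next (0 :: c') x | x <- iota 1 i.-1].
  by rewrite /word_line /mkseq szc -(prednK i_gt0).
have glueE : glue (0 :: c') (0 :: d') = 0 :: (map (addn i) (0 :: d') ++ c').
  by rewrite /glue szc.
have memg x : (x \in glue (0 :: c') (0 :: d')) = (x < i + j).
  rewrite glueE inE mem_cat; case: (ltnP x i) => xi.
    rewrite (_ : x \in map _ _ = false); last by apply/mapP => -[y _]; lia.
    by have := memc x; rewrite inE /= xi; lia.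
  rewrite -(subnKC xi) mem_map // memd.
  have : i + (x - i) \in 0 :: c' = false by rewrite memc; lia.
  by rewrite inE; lia.
have iotaE : iota 0 i = 0 :: iota 1 i.-1 by rewrite -{1}(prednK i_gt0).
rewrite headE line_c /word_line /mkseq szg szd iotaD iotaE map_cat map_cons -[RHS]cat_cons.
congr (_ ++ _).
  congr (_ :: _).
    by rewrite glueE /= ?eqxx ?addn0.
  (* Entries of [c'] keep their successor, including the return from the last one to 0, which is the
     default value of [nth]. *)
  apply/eq_in_map => x; rewrite mem_iota => xi.
  have xn0 : x != 0 by lia.
  have xc : x \in c' by have := memc x; rewrite inE (negPf xn0) /=; lia.
  rewrite next_cons0 ?inE ?xc ?orbT // glueE next_cons0; last by rewrite -glueE memg; lia.
  rewrite !index0 // index_cat (_ : x \in map _ _ = false); last by apply/mapP => -[y _]; lia.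
  by rewrite nth_cat -addnS ltnNge leq_addr /= addKn.
rewrite add0n -{1}(addn0 i) iotaDl -!map_comp.
apply/eq_in_map => y; rewrite mem_iota add0n => /andP[_ yj]; rewrite /comp.
have yd : y \in 0 :: d' by rewrite memd.
rewrite next_cons0 // glueE next_cons0; last by rewrite -glueE memg; lia.
have iy0 : i + y != 0 by lia.
rewrite index0 // index_cat mem_map // yd index_map //.
have : index y (0 :: d') < size (0 :: d') by rewrite index_mem.
move: (index y _) => k k_lt.
(* Either [y] has a successor inside [d'], which is nonzero, or [y] is the last entry of the second
   cycle and is now followed by the first entry of [c']. *)
rewrite nth_cat size_map; case: (ltnP k.+1 (size (0 :: d'))) => lt.
  rewrite (nth_map 0) // [nth 0 (0 :: d') _]/=.
  case: eqP => // n0; have : 0 \in d' by rewrite -n0 mem_nth.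
  by case/andP: ud => /negPf->.
have -> : k = size d' by move: lt k_lt => /=; lia.
by rewrite [size (0 :: d')]/= subnn (nth_default _ (leqnn _)) eqxx.
Qed.


(** * Unique decomposition of cycle words *)

(** A leading 0 could only play the 2 of the pattern, but nothing is smaller. *)
Lemma avoids213_cons0 s : avoids (0 :: s) pat213 = avoids s pat213.
Proof.
apply/idP/idP; first exact: avoids213_subseq (subseq_cons _ _).
move=> /avoids213P H; apply/avoids213P => -[|x] y z //=.
exact: H.
Qed.

Lemma avoids213_cat b s t : all (leq b) s -> all (ltn^~ b) t ->
  avoids s pat213 -> avoids t pat213 -> avoids (s ++ t) pat213.
Proof.
move=> sb tb /avoids213P Hs /avoids213P Ht; apply/avoids213P => x y z sub yx xz.
(* No entry that is at least [b] comes after an entry below [b]. Hence an occurrence of 213 whose 2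
   is at least [b] has its 3, and then its 1, in [s]; otherwise it lies in [t]. *)
have : pairwise (fun u v => (v < b) || (b <= u)) (s ++ t).
  rewrite pairwise_cat; apply/and3P; split.
  - apply/allrelP => u v us vt.
    by move/allP/(_ v vt): tb => /= ->.
  - elim: s sb {Hs sub} => //= u s IHs /andP[bu /IHs ->].
    by rewrite andbT; apply/allP => v _; rewrite bu orbT.
  - elim: t tb {Ht sub} => //= u t IHt /andP[bu tb]; rewrite IHt // andbT.
    by apply/allP => v /(allP tb) /= ->.
move/(subseq_pairwise sub) => /= /and3P[/and3P[xy xz' _] /andP[yz _] _].
have sE : [seq u <- s ++ t | b <= u] = s.
  rewrite filter_cat (all_filterP sb) (eq_in_filter (a2 := pred0)).
    by rewrite filter_pred0 cats0.
  by move=> u /(allP tb) /=; lia.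
have tE : [seq u <- s ++ t | u < b] = t.
  rewrite filter_cat (all_filterP tb) (eq_in_filter (a2 := pred0)).
    by rewrite filter_pred0.
  by move=> u /(allP sb) /=; lia.
case: (leqP b x) => bx.
  by apply: (Hs x y z) => //; rewrite -sE subseq_filter sub /= !andbT; lia.
by apply: (Ht x y z) => //; rewrite -tE subseq_filter sub /= !andbT; lia.
Qed.

(** An entry below [x] followed by one above [x] would complete a 213 with [x] as its 2. *)
Lemma avoids213_cons_split x s : x \notin s -> avoids (x :: s) pat213 ->
  s = [seq y <- s | x < y] ++ [seq y <- s | y < x].
Proof.
elim: s => //= y s IHs; rewrite inE negb_or => /andP[xy xs] av.
case: (ltngtP x y) => [lt|gt|eq].
- rewrite /= -IHs //; apply: avoids213_subseq av.
  by rewrite -[x :: s]cat1s -[[:: x, y & s]]cat1s cat_subseq // subseq_cons.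
- have s_lt : all (ltn^~ x) s.
    apply/allP=> z zs /=; case: (ltngtP x z) => // [xz|zx]; last by rewrite zx zs in xs.
    case: (avoids213P _ av x y z) => //=; rewrite !eqxx.
    by rewrite sub1seq.
  rewrite (all_filterP s_lt) (eq_in_filter (a2 := pred0)) ?filter_pred0 //.
  by move=> z /(allP s_lt) /=; lia.
- by rewrite eq eqxx in xy.
Qed.

Lemma glue_cycle_words i j c d :
  c \in cycle_words i -> d \in cycle_words j -> glue c d \in cycle_words (i + j).
Proof.
case/cycle_wordsP=> c' [-> uc szc memc avc] /cycle_wordsP[d' [-> ud szd memd avd]].
rewrite /glue szc [behead _]/=; set e := 0 :: d' in ud szd memd avd *.
have i_gt0 : 0 < i by rewrite -szc.
have c'lt x : x \in c' -> 0 < x < i.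
  move=> xc; have := memc x; rewrite inE xc orbT => <-; rewrite andbT lt0n.
  by apply: contraTneq xc => ->; case/andP: uc.
have add_inj : injective (addn i) by move=> x y; lia.
apply: cycle_words_intro.
- rewrite cons_uniq mem_cat cat_uniq map_inj_uniq // ud.
  have := uc; rewrite cons_uniq => /andP[c0 ->].
  rewrite (negPf c0) orbF andbT andTb; apply/andP; split.
    by apply/mapP => -[y _]; lia.
  by apply/hasPn => x /c'lt xi; apply/mapP => -[y _]; lia.
- by move: szc szd; rewrite /e /= size_cat size_map; lia.
- move=> x; rewrite mem_cat => /orP[/mapP[y]|/c'lt]; last by lia.
  by rewrite memd => yj ->; rewrite ltn_add2l.
- rewrite avoids213_cons0; apply: (@avoids213_cat i).
  + by apply/allP => _ /mapP[y _ ->]; rewrite leq_addr.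
  + by apply/allP => x /c'lt /andP[].
  + by rewrite avoids213_map // => x y; rewrite ltn_add2l.
  + by rewrite -avoids213_cons0.
Qed.

(** The second entry [i] of [g] is the size of [c]: the later entries below [i], with 0 in front,
    use each value below [i] once, and [i] with the entries above it, shifted down, gives [d]. *)
Lemma cycle_words_split n g : 1 < n -> g \in cycle_words n ->
  exists i c d, [/\ 0 < i < n, c \in cycle_words i, d \in cycle_words (n - i)
                  & g = glue c d].
Proof.
move=> n_gt1 /cycle_wordsP[[|i r] [-> ug szg memg avg]]; first by move: szg => /=; lia.
have := ug; rewrite !cons_uniq inE negb_or => /andP[/andP[i_neq0 r0] /andP[ir ur]].
have in_r x : x != 0 -> x != i -> (x \in r) = (x < n).
  by move=> x0 xi; rewrite -memg !inE (negPf x0) (negPf xi).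
have i_n : i < n by rewrite -memg !inE eqxx orbT.
have avi : avoids (i :: r) pat213 by rewrite -avoids213_cons0.
have rE := avoids213_cons_split ir avi.
set L := [seq y <- r | i < y] in rE; set S := [seq y <- r | y < i] in rE.
have pS : perm_eq (0 :: S) (iota 0 i).
  apply: uniq_perm; rewrite ?iota_uniq //.
    by rewrite cons_uniq filter_uniq // andbT mem_filter (negPf r0) andbF.
  move=> x; rewrite inE mem_filter mem_iota /= add0n.
  case: (eqVneq x 0) => [->|x0] /=; first by lia.
  by case: (ltnP x i) => //= xi; rewrite in_r //; lia.
have szS : (size S).+1 = i by have := perm_size pS; rewrite size_iota.
have gS : subseq (0 :: S) [:: 0, i & r].
  apply: (@cat_subseq _ [:: 0] S [:: 0] (i :: r)) => //.
  exact: subseq_trans (filter_subseq _ _) (subseq_cons _ _).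
have iL : map (addn i) (0 :: map (subn^~ i) L) = i :: L.
  rewrite /= addn0 -map_comp -[RHS]/(i :: L); congr (_ :: _).
  rewrite -[RHS]map_id; apply/eq_in_map => x; rewrite mem_filter => /andP[ix _] /=.
  by rewrite subnKC // ltnW.
exists i, (0 :: S), (0 :: map (subn^~ i) L); split.
- by rewrite i_n lt0n eq_sym i_neq0.
- by rewrite mem_cycle_words pS eqxx (avoids213_subseq gS).
- apply: cycle_words_intro.
  + rewrite -(map_inj_uniq (f := addn i)); last by move=> x y; lia.
    rewrite iL cons_uniq filter_uniq // mem_filter ltnn //.
  + rewrite /= size_map; move: szg; rewrite [X in size (_ :: _ :: X)]rE /= size_cat.
    by lia.
  + move=> y /mapP[x]; rewrite mem_filter => /andP[ix xr] ->.
    by have := memg x; rewrite !inE xr !orbT; lia.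
  + rewrite -(@avoids213_map (addn i)); last by move=> x y; rewrite ltn_add2l.
    rewrite iL; apply: avoids213_subseq avi.
    by rewrite /= eqxx filter_subseq.
- by rewrite /glue [size _]/= szS iL /= -rE.
Qed.

Lemma perm_cycle_words n : 1 < n ->
  perm_eq (cycle_words n)
    [seq glue p.1 p.2 | i <- iota 1 n.-1,
                        p <- [seq (c, d) | c <- cycle_words i, d <- cycle_words (n - i)]].
Proof.
move=> n_gt1; apply: uniq_perm; first exact: cycle_words_uniq.
  apply: allpairs_uniq_dep; first exact: iota_uniq.
    by move=> i _; apply: allpairs_uniq; rewrite ?cycle_words_uniq // => -[? ?] [? ?].
  move=> u v /allpairsPdep[i [_ [_ /allpairsP[[c d] /= [ci di ->]] ->]]].
  move=> /allpairsPdep[j [_ [_ /allpairsP[[c1 d1] /= [cj dj ->]] ->]]] /=.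
  have [c' [cE _ szc _ _]] := cycle_wordsP ci.
  have [c1' [c1E _ szc1 _ _]] := cycle_wordsP cj.
  have [d' [dE _ szd _ _]] := cycle_wordsP di.
  have [d1' [d1E _ szd1 _ _]] := cycle_wordsP dj.
  rewrite /glue szc szc1 => -[eq].
  (* As [d] starts with 0, the second entry of a glued word is the size of its first factor; the
     sizes then determine where to cut. *)
  have ij : i = j by move: eq; rewrite dE d1E /= !addn0 => -[].
  rewrite -{}ij in szc1 szd1 eq cj dj *.
  move/eqP: eq; rewrite eqseq_cat ?size_map ?szd // => /andP[/eqP/inj_map dd /eqP cc].
  by rewrite dd; [move: cc; rewrite cE c1E /= => -> | move=> x y; lia].
move=> g; apply/idP/allpairsPdep.
  case/(cycle_words_split n_gt1) => i [c [d [i_n ci di ->]]].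
  exists i, (c, d); split=> //; first by rewrite mem_iota; lia.
  by apply/allpairsP; exists (c, d).
case=> i [_ [i_n /allpairsP[[c d] /= [ci di ->]] ->]] /=.
rewrite (_ : n = i + (n - i)); first exact: glue_cycle_words.
by move: i_n; rewrite mem_iota; lia.
Qed.

Lemma count_allpairs (S T : eqType) (P : pred (S * T)) (p : pred S) (q : pred T) s t :
  {in s & t, forall x y, P (x, y) = p x && q y} ->
  count P [seq (x, y) | x <- s, y <- t] = count p s * count q t.
Proof.
elim: s => //= x s IHs Hp; rewrite count_cat IHs; last first.
  by move=> u v us vt; apply: Hp; rewrite ?inE ?us ?orbT.
rewrite mulnDl; congr (_ + _); rewrite count_map.
rewrite (eq_in_count (a2 := fun y => p x && q y)); last first.
  by move=> y yt /=; rewrite Hp ?mem_head.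
by case: (p x); rewrite ?mul1n // count_pred0.
Qed.

(** The common source of the recurrences: a condition on glued words that splits over the factors
    gives a convolution. The two conditions may depend on the size [i] of the first factor. *)
Lemma count_cycle_words n (P : pred (seq nat)) (p q : nat -> pred (seq nat)) : 1 < n ->
  (forall i c d, 0 < i < n -> c \in cycle_words i -> d \in cycle_words (n - i) ->
     P (glue c d) = p i c && q i d) ->
  count P (cycle_words n) =
    \sum_(1 <= i < n) count (p i) (cycle_words i) * count (q i) (cycle_words (n - i)).
Proof.
move=> n_gt1 HP; rewrite (seq.permP (perm_cycle_words n_gt1)) count_flatten sumnE !big_map.
rewrite /index_iota subn1 big_seq [RHS]big_seq; apply: eq_bigr => i.
rewrite mem_iota => i_n; rewrite count_map; apply: count_allpairs => c d ci di /=.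
by apply: HP => //; lia.
Qed.


(** * Decreasing subsequences of a glued line *)

Definition pos (s : seq nat) := [seq x <- s | 0 < x].

Section GluedLine.

Variables (i h : nat) (s t : seq nat).
Hypotheses (h_lt : h < i) (s_lt : all (ltn^~ i) s) (t0 : [seq x <- t | x == 0] = [:: 0]).

(** Here [h :: s] stands for the line of the first factor, of size [i], and [t] for the line of the
    second. Sending 0 to [h] preserves the order because [h < i]. *)
Let f x := if x == 0 then h else i + x.

Let f_mono : {mono f : x y / x < y}.
Proof. by move=> x y; rewrite /f; case: eqP; case: eqP; lia. Qed.

Let f_small : [seq x <- map f t | x < i] = [:: h].
Proof.
rewrite filter_map (eq_filter (a2 := fun x => x == 0)) ?t0 //.
by move=> x /=; rewrite /f; case: eqP; lia.
Qed.

Let f_large : [seq x <- map f t | i < x] = map f (pos t).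
Proof.
rewrite filter_map; congr map; apply: eq_filter => x /=.
by rewrite /f; case: eqP; lia.
Qed.

(** Below the leading [i] there are only [s] and [h]. Without [i], a decreasing subsequence meeting
    [s] stays in [s] and [h], and any other lies in an order-isomorphic copy of [t]. *)
Lemma lds_glued : lds (i :: s ++ map f t) = maxn (lds (rcons s h)).+1 (lds t).
Proof.
rewrite lds_cons filter_cat (all_filterP s_lt) f_small (lds_cat _ s_lt) f_small.
by rewrite lds_map // cats1; lia.
Qed.

(** The entry [i], now last, extends exactly the decreasing subsequences made of images of nonzero
    entries of [t]; by [lds_leq_pos] this also bounds [lds t]. *)
Lemma lds_rot_glued :
  lds (rot 1 (i :: s ++ map f t)) = maxn (lds (rcons s h)) (lds (pos t)).+1.
Proof.
rewrite rot1_cons rcons_cat (lds_cat _ s_lt) filter_rcons ltnn f_small cats1.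
rewrite [lds (rcons (map _ _) _)]lds_rcons f_large !lds_map //.
by have := lds_leq_pos t; rewrite -/(pos t); lia.
Qed.

(** As [h > 0], no entry of [map f t] is 0, so deleting zeros affects only [s]. *)
Lemma lds_pos_glued : 0 < h ->
  lds (pos (i :: s ++ map f t)) = maxn (lds (pos (rcons s h))).+1 (lds t).
Proof.
move=> h_gt0; have i_gt0 : 0 < i by lia.
have ps_lt : all (ltn^~ i) (pos s) by apply/allP => x; rewrite mem_filter => /andP[_ /(allP s_lt)].
have -> : pos (i :: s ++ map f t) = i :: pos s ++ map f t.
  rewrite /pos [filter _ (_ :: _)]/= i_gt0 filter_cat; congr (_ :: _ ++ _).
  by apply/all_filterP/allP => _ /mapP[x _ ->]; rewrite /f; case: eqP; lia.
rewrite lds_cons filter_cat (all_filterP ps_lt) f_small (lds_cat _ ps_lt) f_small.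
by rewrite lds_map // /pos filter_rcons h_gt0 cats1; lia.
Qed.

(** The sign of [h] does not matter: a zero in [map f t] lengthens a decreasing subsequence by at
    most one, and the final [i] already accounts for that. *)
Lemma lds_pos_rot_glued :
  lds (pos (rot 1 (i :: s ++ map f t))) =
    maxn (lds (pos (rcons s h))) (lds (pos t)).+1.
Proof.
have i_gt0 : 0 < i by lia.
have ps_lt : all (ltn^~ i) (pos s) by apply/allP => x; rewrite mem_filter => /andP[_ /(allP s_lt)].
rewrite rot1_cons rcons_cat /pos filter_cat filter_rcons i_gt0 -!/(pos _) (lds_cat _ ps_lt).
rewrite filter_rcons ltnn filterC f_small.
rewrite lds_rcons filterC f_large.
have -> : [seq x <- map f (pos t) | 0 < x] = map f (pos t).
  apply/all_filterP/allP => y /mapP[x]; rewrite mem_filter => /andP[x0 _] ->.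
  by rewrite /f; case: eqP; lia.
rewrite lds_map // -filter_cat cats1.
have := lds_leq_pos t; have := lds_filter (ltn 0) (map f t).
by rewrite lds_map // -!/(pos _); lia.
Qed.

End GluedLine.

(** The case [h = 0], met when the first factor is a single fixed point: the zero deleted is the
    image of the minimum of [t], and the leading [i] lies below all that remains. *)
Lemma lds_pos_shift i t : 0 < i ->
  lds (pos (i :: [seq if x == 0 then 0 else i + x | x <- t])) = maxn 1 (lds (pos t)).
Proof.
move=> i_gt0; rewrite /pos [filter _ (_ :: _)]/= i_gt0 filter_map.
rewrite (eq_filter (a2 := ltn 0)); last by move=> x /=; case: eqP; lia.
rewrite lds_cons -/(pos t) lds_map; last by move=> x y; case: eqP; case: eqP; lia.
rewrite (eq_in_filter (a2 := pred0)) ?filter_pred0 /=; first by lia.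
by move=> y /mapP[x]; rewrite mem_filter /= => x0 ->; case: eqP; lia.
Qed.

Lemma word_lineP i c : c \in cycle_words i ->
  exists h s, [/\ word_line c = h :: s, h < i, all (ltn^~ i) s &
     (1 < i -> 0 < h) /\ (i = 1 -> h = 0 /\ s = [::])].
Proof.
move=> ci; have pl := perm_word_line ci.
have [c' [cE uc szc memc _]] := cycle_wordsP ci.
have all_lt x : x \in word_line c -> x < i by rewrite (perm_mem pl) mem_iota.
exists (head 0 (word_line c)), (behead (word_line c)).
have lE : word_line c = head 0 (word_line c) :: behead (word_line c) by rewrite cE.
split=> //.
- by apply: all_lt; rewrite {2}lE mem_head.
- by apply/allP => x xs; apply: all_lt; rewrite lE inE xs orbT.
split=> [i_gt1|i1]; last first.
  have : word_line c = [:: 0] by apply/perm_small_eq; rewrite ?i1 // in pl *.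
  by move=> ->.
rewrite cE /= in szc uc *; case: (c') szc uc => [|y s] /=; first by lia.
by rewrite inE negb_or => _ /andP[/andP[y0 _] _]; rewrite ?eqxx lt0n eq_sym.
Qed.

Lemma word_line0 i c : c \in cycle_words i -> [seq x <- word_line c | x == 0] = [:: 0].
Proof.
move=> ci; have pl := perm_word_line ci.
have [c' [cE uc szc memc _]] := cycle_wordsP ci.
apply: perm_small_eq => //; apply: perm_trans (perm_filter _ pl) _.
by rewrite -szc cE /= (eq_in_filter (a2 := pred0)) ?filter_pred0 // => x; rewrite mem_iota /=; lia.
Qed.

(** * Convolution recurrences for the four counts *)

Definition stat_count (st : seq nat -> nat) n k :=
  count (fun c => st (word_line c) < k) (cycle_words n).

Definition count_line := stat_count lds.
Definition count_rot := stat_count (fun w => lds (rot 1 w)).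
Definition count_pos := stat_count (fun w => lds (pos w)).
Definition count_pos_rot := stat_count (fun w => lds (pos (rot 1 w))).

Lemma ltn_maxS m n k : (maxn m.+1 n < k) = (m < k.-1) && (n < k).
Proof. by rewrite gtn_max; case: k => //= k; rewrite andbF. Qed.

Lemma count_line_rec n k : 1 < n ->
  count_line n k = \sum_(1 <= i < n) count_rot i k.-1 * count_line (n - i) k.
Proof.
move=> n_gt1; apply: count_cycle_words => // i c d i_n ci di.
rewrite (glue_line ci di); have [h [s [-> h_lt s_lt _]]] := word_lineP ci.
by rewrite lds_glued ?(word_line0 di) // ltn_maxS rot1_cons.
Qed.

Lemma count_rot_rec n k : 1 < n ->
  count_rot n k = \sum_(1 <= i < n) count_rot i k * count_pos (n - i) k.-1.
Proof.
move=> n_gt1; apply: count_cycle_words => // i c d i_n ci di.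
rewrite (glue_line ci di); have [h [s [-> h_lt s_lt _]]] := word_lineP ci.
by rewrite lds_rot_glued ?(word_line0 di) // maxnC ltn_maxS rot1_cons andbC.
Qed.

Lemma count_pos_rot_rec n k : 1 < n ->
  count_pos_rot n k = \sum_(1 <= i < n) count_pos_rot i k * count_pos (n - i) k.-1.
Proof.
move=> n_gt1; apply: count_cycle_words => // i c d i_n ci di.
rewrite (glue_line ci di); have [h [s [-> h_lt s_lt _]]] := word_lineP ci.
by rewrite lds_pos_rot_glued ?(word_line0 di) // maxnC ltn_maxS rot1_cons andbC.
Qed.

Lemma cycle_words1 : cycle_words 1 = [:: [:: 0]].
Proof.
apply: perm_small_eq => //; apply: uniq_perm; rewrite ?cycle_words_uniq // => c.
rewrite mem_seq1; apply/idP/eqP => [/cycle_wordsP[[|? ?] [-> _ //]]|->].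
apply: cycle_words_intro => //; apply/avoids213P => x y z.
by move/size_subseq.
Qed.

Lemma count_pos_rec n k : 1 < n -> count_pos n k =
  (1 < k) * count_pos n.-1 k
    + \sum_(2 <= i < n) count_pos_rot i k.-1 * count_line (n - i) k.
Proof.
move=> n_gt1.
(* For [i = 1] the first factor is [[:: 0]] and [lds_pos_shift] applies; its bound 1 becomes the
   condition [1 < k]. *)
pose p i c := if i == 1 then 1 < k else lds (pos (rot 1 (word_line c))) < k.-1.
pose q i d := (if i == 1 then lds (pos (word_line d)) else lds (word_line d)) < k.
rewrite /count_pos /stat_count (@count_cycle_words n _ p q) // => [|i c d i_n ci di].
  rewrite big_ltn // cycle_words1 /p /q /= addn0 subn1; congr (_ + _).
  apply: eq_big_nat => i i_n; have -> : (i == 1) = false by lia.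
  by [].
rewrite (glue_line ci di) /p /q.
have [h [s [-> h_lt s_lt [h_gt0 h0]]]] := word_lineP ci.
have [i1|i1] := eqVneq i 1.
  by have [-> ->] := h0 i1; rewrite /= lds_pos_shift ?gtn_max; lia.
by rewrite lds_pos_glued ?(word_line0 di) ?h_gt0 ?ltn_maxS ?rot1_cons //; lia.
Qed.

Lemma count_line1 k : count_line 1 k = (1 < k).
Proof. by rewrite /count_line /stat_count cycle_words1 /= addn0. Qed.
Lemma count_rot1 k : count_rot 1 k = (1 < k).
Proof. by rewrite /count_rot /stat_count cycle_words1 /= addn0. Qed.
Lemma count_pos1 k : count_pos 1 k = (0 < k).
Proof. by rewrite /count_pos /stat_count cycle_words1 /= addn0. Qed.
Lemma count_pos_rot1 k : count_pos_rot 1 k = (0 < k).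
Proof. by rewrite /count_pos_rot /stat_count cycle_words1 /= addn0. Qed.

(** * Values for small [k] and equality of the counts *)

Lemma stat_count0 st n : stat_count st n 0 = 0.
Proof. by rewrite /stat_count (eq_count (a2 := pred0)) ?count_pred0. Qed.

(** Both counts obey the same recurrence, and for [k > 1] they agree at size 1. *)
Lemma count_pos_rot_eq n k : 0 < n -> 1 < k -> count_pos_rot n k = count_rot n k.
Proof.
move=> n_gt0 k_gt1; elim/ltn_ind: n n_gt0 => n IHn n_gt0.
case: (ltngtP n 1) => [|n_gt1|->]; first by lia.
  rewrite count_pos_rot_rec // count_rot_rec //.
  by apply: eq_big_nat => i i_n; rewrite IHn //; lia.
by rewrite count_pos_rot1 count_rot1; lia.
Qed.

Lemma count_pos_k1 n : 1 < n -> count_pos n 1 = 0.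
Proof.
move=> n_gt1; rewrite count_pos_rec // mul0n big1_seq // => i _.
by rewrite /count_pos_rot stat_count0.
Qed.

Lemma count_rot_k2 n : 0 < n -> count_rot n 2 = 1.
Proof.
case: n => // n _; elim: n => [|n IHn]; first by rewrite count_rot1.
(* Only the last summand survives, where the second factor has size 1. *)
rewrite count_rot_rec // big_nat_recr //= IHn big1_seq ?subSnn ?count_pos1 // => i.
by rewrite mem_index_iota => /andP[_ i_n]; rewrite count_pos_k1 ?muln0 //; lia.
Qed.

Lemma count_pos_k2 n : 0 < n -> count_pos n 2 = 1.
Proof.
case: n => // n _; elim: n => [|n IHn]; first by rewrite count_pos1.
rewrite count_pos_rec //= IHn big1_seq // => i; rewrite mem_index_iota => /andP[_ i_n].
rewrite count_pos_rot_rec; last by lia.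
by rewrite big1_seq // => j _; rewrite /count_pos stat_count0 muln0.
Qed.

Lemma sum_mul_rev n (F G : nat -> nat) :
  \sum_(1 <= i < n) F i * G (n - i) = \sum_(1 <= i < n) G i * F (n - i).
Proof.
rewrite big_nat_rev /=; apply: eq_big_nat => i i_n; rewrite mulnC.
by congr (G _ * F _); lia.
Qed.

(* Let A_k, B_k, C_k be the generating functions of [count_line], [count_rot],
   [count_pos]. The recurrences read A_k = x + B_{k-1} A_k,
   B_k = x + B_k C_{k-1} and C_k = x + x C_k + (B_{k-1} - x) A_k for k >= 3, so
   B_{k-1} = C_{k-1} gives A_k = B_k; then C_k - A_k = x (C_k - A_k), so C_k = A_k. *)
Lemma counts_eq k n : 2 < k -> 0 < n ->
  count_rot n k = count_line n k /\ count_pos n k = count_line n k.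
Proof.
case: k => // k; rewrite ltnS => k_gt1.
elim: k k_gt1 n => // k IHk k_gt0 n n_gt0.
(* This is B = C one level down: both counts are 1 at level 2, and higher levels follow by
   induction. *)
have rot_pos m : 0 < m -> count_rot m k.+1 = count_pos m k.+1.
  move=> m_gt0; have [k1|k1] := eqVneq k 1; first by rewrite k1 count_rot_k2 ?count_pos_k2.
  by have [] // := IHk _ m m_gt0; [lia | move=> -> ->].
elim/ltn_ind: n n_gt0 => n IHn n_gt0.
case: (ltngtP n 1) => [|n_gt1|->]; first by lia.
  split.
    rewrite count_rot_rec // count_line_rec //.
    transitivity (\sum_(1 <= i < n) count_line i k.+2 * count_rot (n - i) k.+1); last first.
      exact: (sum_mul_rev n (count_line^~ k.+2) (count_rot^~ k.+1)).
    apply: eq_big_nat => i i_n /=; rewrite (rot_pos (n - i)); last by lia.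
    by have [| |-> _] := IHn i; lia.
  (* The separate term for [count_pos] matches the summand [i = 1] for [count_line], by induction on
     the size. *)
  rewrite count_pos_rec // count_line_rec // [RHS]big_ltn //= count_rot1 subn1.
  have [| |_ ->] := IHn n.-1; [lia|lia|].
  congr (_ * _ + _); first by lia.
  by apply: eq_big_nat => i i_n; rewrite count_pos_rot_eq //; lia.
by rewrite count_rot1 count_line1 count_pos1.
Qed.


(** * Cyclic permutations and cycle words *)

Lemma cycle_form_traject m (s : 'S_m.+1) :
  cycle_form s = map val (traject s ord0 m.+1).
Proof.
apply: (@eq_from_nth _ 0); first by rewrite !size_map size_iota size_traject.
move=> i; rewrite size_map size_iota => i_m.
rewrite (nth_map 0) ?size_iota // nth_iota // (nth_map ord0) ?size_traject //.
by rewrite nth_traject // permX.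
Qed.

Lemma cyclic_permP m (s : 'S_m.+1) : reflect (porbit s ord0 = setT) (cyclic_perm s).
Proof.
apply: (iffP cards1P) => [[A sA]|s0].
  have porbitE x : porbit s x = A by apply/set1P; rewrite -sA; apply: imset_f.
  by apply/setP => x; rewrite inE porbitE -(porbitE x) porbit_id.
exists setT; apply/setP => A; rewrite inE; apply/imsetP/eqP => [[x _ ->]|->].
  have : x \in porbit s ord0 by rewrite s0.
  by rewrite -eq_porbit_mem => /eqP ->.
by exists ord0.
Qed.

Section CyclicPerm.

Variables (m : nat) (s : 'S_m.+1).
Hypothesis cyc : cyclic_perm s.

Let orb : #|porbit s ord0| = m.+1.
Proof. by rewrite (cyclic_permP s cyc) cardsT card_ord. Qed.

Let uniq_orbit : uniq (traject s ord0 m.+1).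
Proof. by have := uniq_traject_porbit s ord0; rewrite orb. Qed.

Let mem_orbit x : x \in traject s ord0 m.+1.
Proof.
by have := porbit_traject s ord0 x; rewrite orb => <-; rewrite (cyclic_permP s cyc).
Qed.

Lemma perm_cycle_form : perm_eq (cycle_form s) (iota 0 m.+1).
Proof.
rewrite cycle_form_traject; apply: uniq_perm; rewrite ?iota_uniq ?(map_inj_uniq val_inj) // => x.
rewrite mem_iota add0n leq0n andTb; apply/mapP/idP => [[y _ ->]|x_m]; first exact: ltn_ord.
by exists (Ordinal x_m).
Qed.

(** The orbit of 0 closes up after [m.+1] steps, so cyclic succession in the cycle form is [s]
    itself. *)
Lemma next_cycle_form x : next (cycle_form s) (val x) = val (s x).
Proof.
rewrite cycle_form_traject next_map //; last exact: val_inj.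
congr val; apply/esym/eqP; apply: (next_cycle (e := frel s)) (mem_orbit x).
have end0 : iter m s (s ord0) = ord0.
  by have := iter_porbit s ord0; rewrite orb iterSr.
by rewrite /= -[X in rcons _ X]end0 -trajectSr fpath_traject.
Qed.

Lemma one_line_cycle_form : one_line s = word_line (cycle_form s).
Proof.
rewrite /word_line /mkseq size_map size_iota -val_enum_ord -map_comp /one_line.
by apply: eq_map => x; rewrite /= -next_cycle_form.
Qed.

End CyclicPerm.

Lemma cycle_form_inj m : {in [pred s : 'S_m.+1 | cyclic_perm s] &, injective (@cycle_form m)}.
Proof.
move=> s t cs ct eq; apply/permP => x; apply: val_inj.
by rewrite /= -!next_cycle_form // eq.
Qed.

(** The permutation is [next c], whose iterates from 0 run through [c] in order. *)
Lemma cycle_form_surj m c : c \in cycle_words m.+1 ->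
  exists2 s : 'S_m.+1, cyclic_perm s & cycle_form s = c.
Proof.
case/cycle_wordsP=> c' [cE uc szc memc _].
have next_lt (x : 'I_m.+1) : next c x < m.+1 by rewrite -memc mem_next memc.
pose f x := Ordinal (next_lt x).
have f_inj : injective f.
  by move=> x y /(congr1 val) /(can_inj (prev_next uc)) /val_inj.
have iterE i : i < m.+1 -> val ((perm f_inj ^+ i)%g ord0) = nth 0 c i.
  elim: i => [|i IHi] i_m; first by rewrite expg0 perm1 cE.
  rewrite expgSr permM permE /= IHi; last by lia.
  have ci : nth 0 c i \in c by rewrite mem_nth // szc ltnW.
  by rewrite next_nth ci index_uniq ?szc 1?ltnW // cE.
have cfE : cycle_form (perm f_inj) = c.
  apply: (@eq_from_nth _ 0); first by rewrite size_map size_iota szc.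
  move=> i; rewrite size_map size_iota => i_m.
  by rewrite (nth_map 0) ?size_iota // nth_iota // iterE.
exists (perm f_inj) => //; apply/cyclic_permP/setP => x; rewrite inE.
have : val x \in c by rewrite memc; apply: ltn_ord.
rewrite -cfE => /mapP[i _ /val_inj ->]; exact: mem_porbit.
Qed.

Lemma a_count_line n k : 0 < n -> a n k = count_line n k.
Proof.
case: n => // m _; rewrite /a /count_line /stat_count -size_filter cardE -(size_map (@cycle_form m)).
apply/perm_size/uniq_perm.
- rewrite map_inj_in_uniq ?enum_uniq // => s t; rewrite !mem_enum !inE => /andP[cs _] /andP[ct _].
  exact: cycle_form_inj.
- by rewrite filter_uniq // cycle_words_uniq.
move=> c; rewrite mem_filter; apply/mapP/andP => [[s]|[lk cw]].
  rewrite mem_enum inE => /and3P[cs av1 av2] ->; split.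
    by rewrite -one_line_cycle_form // -avoids_delta.
  by rewrite mem_cycle_words perm_cycle_form // av2 andbT /= expg0 perm1.
have [s cs cE] := cycle_form_surj cw; exists s => //.
rewrite mem_enum inE cs avoids_delta one_line_cycle_form // cE lk /=.
by move: cw; rewrite mem_cycle_words => /and3P[].
Qed.

(** * Base cases and the final recurrence *)

Lemma count_line_k2 n : 1 < n -> count_line n 2 = 0.
Proof.
move=> n_gt1; rewrite count_line_rec // big1_seq // => i.
rewrite mem_index_iota => /andP[_ i_n] /=.
case: (ltngtP i 1) => [|i_gt1|->]; first by lia.
  rewrite count_rot_rec // big1_seq // => j _.
  by rewrite /count_pos stat_count0 muln0.
by rewrite count_rot1.
Qed.

(** Since [count_rot i 2] is 1, each value is the sum of all earlier ones, so the values double from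
    size 2 on. *)
Lemma count_line_k3 n : 1 < n -> count_line n 3 = 2 ^ (n - 2).
Proof.
case: n => [|[|n]] // _; rewrite subn2 /=.
have rec m : 1 < m -> count_line m 3 = \sum_(1 <= i < m) count_line i 3.
  move=> m_gt1; rewrite count_line_rec // big_nat_rev /=.
  apply: eq_big_nat => i i_m; rewrite count_rot_k2 ?mul1n; last by lia.
  by congr (count_line _ _); lia.
elim: n => [|n IHn]; first by rewrite rec // big_nat1 count_line1.
by rewrite rec // big_nat_recr //= -rec // IHn expnS mul2n addnn.
Qed.

Theorem theorem2p1 :
  (forall n k : nat, 2 <= n -> 4 <= k ->
     a n k = \sum_(1 <= i < n) a i k * a (n - i) k.-1) /\
  a 1 1 = 0 /\
  (forall k : nat, 2 <= k -> a 1 k = 1) /\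
  (forall n : nat, 2 <= n -> a n 1 = 0 /\ a n 2 = 0) /\
  (forall n : nat, 2 <= n -> a n 3 = 2 ^ (n - 2)).
Proof.
split; [|split; [|split; [|split]]].
- move=> n k n_gt1 k_gt3; rewrite a_count_line ?count_line_rec; try lia.
  rewrite (sum_mul_rev n (count_rot^~ k.-1) (count_line^~ k)).
  apply: eq_big_nat => i i_n; rewrite !a_count_line; try lia.
  (* The bound [k >= 4] enters here, as [counts_eq] is applied at [k.-1 > 2]. *)
  by have [||-> _] := @counts_eq k.-1 (n - i); lia.
- by rewrite a_count_line ?count_line1.
- by move=> k k_gt1; rewrite a_count_line ?count_line1 ?k_gt1.
- move=> n n_gt1; rewrite !a_count_line ?(ltnW n_gt1) // count_line_k2 //; split=> //.
  rewrite count_line_rec // big1_seq // => i _.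
  by rewrite /count_rot stat_count0.
- by move=> n n_gt1; rewrite a_count_line ?count_line_k3 // ltnW.
Qed.
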